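(* For every integer $k\geq 2$ there exist a field $\mathbb{K}$ and an arrangement of $$N=2^k+2^{k-1}+\ldots+2+1\;(=2^{k+1}-1)$$ distinct lines in the projective plane $\mathbb{P}^2(\mathbb{K})$ which intersect in triple points only, i.e. every point lying on at least two lines of the arrangement lies on exactly three lines of the arrangement.
   Context: A line arrangement is a finite set of distinct lines in the projective plane $\mathbb{P}^2(\mathbb{K})$ over a field $\mathbb{K}$ (no restriction on the field, in particular positive characteristic is allowed). An intersection point of the arrangement is a point lying on at least two of its lines; it is a triple point if exactly three lines of the arrangement pass through it. *)

(* Defs.v *)
From mathcomp Require Import all_boot all_algebra.
From mathcomp Require Import finmap.

Set Implicit Arguments.
Unset Strict Implicit.
Unset Printing Implicit Defensive.

Local Open Scope fset_scope.

(* P^2(K) is the set of vector lines of K^3; a line of P^2(K) is identified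
   with the vector plane of K^3 whose vector lines are its points. *)
Definition proj_point (K : fieldType) : Type :=
  {p : {vspace 'rV[K]_3} | \dim p == 1}.

Definition proj_line (K : fieldType) : Type :=
  {l : {vspace 'rV[K]_3} | \dim l == 2}.

Definition lies_on (K : fieldType) (p : proj_point K) (l : proj_line K) : bool :=
  (val p <= val l)%VS.

Definition line_arrangement (K : fieldType) : Type := {fset proj_line K}.

Definition lines_through (K : fieldType) (A : line_arrangement K)
    (p : proj_point K) : {fset proj_line K} :=
  [fset l in A | lies_on p l].

Definition intersection_point (K : fieldType) (A : line_arrangement K)
    (p : proj_point K) : bool :=
  2 <= #|` lines_through A p|.

Definition triple_point (K : fieldType) (A : line_arrangement K)
    (p : proj_point K) : bool :=
  #|` lines_through A p| == 3.

(* Main.v *)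
Require Import Defs.
From mathcomp Require Import all_boot all_algebra.
From mathcomp Require Import finmap.
From mathcomp Require Import all_field.
From mathcomp.algebra_tactics Require Import ring.

(** Over the field K with 2^(k+1) elements take, for each nonzero x in K, the
    line with coordinates (x, x^2, x^4). It passes through the point (a : b : c)
    iff x is a root of a X + b X^2 + c X^4. As squaring is additive in
    characteristic 2, the roots in K of this polynomial form an F_2-subspace, and
    there are at most four of them; so they number 1, 2 or 4, and exactly 0, 1 or
    3 of the lines pass through the point. *)

Set Implicit Arguments.
Unset Strict Implicit.
Unset Printing Implicit Defensive.

Import GRing.Theory.
Local Open Scope ring_scope.

Definition frob_poly (K : fieldType) (v : 'rV[K]_3) : {poly K} :=
  Poly [:: 0; v 0 0; v 0 1; 0; v 0 (inord 2)].

Lemma frob_poly_eq0 (K : fieldType) (v : 'rV[K]_3) :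
  (frob_poly v == 0) = (v == 0).
Proof.
apply/eqP/eqP => [/polyP v0|->]; last first.
  by apply/polyP=> i; rewrite coef_Poly coef0 !mxE; case: i => [|[|[|[|[|i]]]]] //=;
    rewrite nth_nil.
apply/rowP=> i; rewrite mxE.
(* The exponents 1, 2, 4 are distinct, so each coordinate of [v] is read off as a single
   coefficient. *)
have -> : v 0 i = (frob_poly v)`_(nth 0 [:: 1; 2; 4] i)%N.
  rewrite coef_Poly; case: i => [[|[|[|i]]] lti] //=;
  by congr (v 0 _); apply/val_inj; rewrite //= inordK.
by rewrite v0 coef0.
Qed.

Lemma horner_frob_poly (K : fieldType) (v : 'rV[K]_3) (x : K) :
  (frob_poly v).[x] = v 0 0 * x + v 0 1 * x ^+ 2 + v 0 (inord 2) * x ^+ 4.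
Proof. by rewrite horner_Poly /=; ring. Qed.

Lemma root_frob_poly0 (K : fieldType) (v : 'rV[K]_3) : root (frob_poly v) 0.
Proof. by rewrite rootE horner_frob_poly !expr0n /= !mulr0 !addr0. Qed.

Lemma horner_frob_polyD (K : fieldType) (v : 'rV[K]_3) (x y : K) :
  2 \in [pchar K] -> (frob_poly v).[x + y] = (frob_poly v).[x] + (frob_poly v).[y].
Proof.
move=> ch2; have sqD (a b : K) : (a + b) ^+ 2 = a ^+ 2 + b ^+ 2.
  by rewrite -!(pFrobenius_autE ch2) pFrobenius_autD_comm //; apply: mulrC.
(* Written as an iterated square, the fourth power is additive too: [sqD] applies twice. *)
have p4 (a : K) : a ^+ 4 = (a ^+ 2) ^+ 2 by rewrite -exprM.
by rewrite !horner_frob_poly !p4 !sqD; ring.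
Qed.

(** The degree bounds the number of roots by 4. Conversely, two distinct nonzero roots [x] and [y]
    yield the roots 0, [x], [y], [x + y], pairwise distinct because [- y = y] in characteristic
    2. *)
Lemma card_roots_frob_poly (K : finFieldType) (v : 'rV[K]_3) :
  2 \in [pchar K] -> v != 0 ->
  (2 < #|[set x : K | root (frob_poly v) x]|)%N ->
  #|[set x : K | root (frob_poly v) x]| = 4.
Proof.
set S := [set x | _] => ch2 v0 S2.
have le4 : (#|S| <= 4)%N.
  rewrite -ltnS cardE.
  apply: leq_trans (size_Poly [:: 0; v 0 0; v 0 1; 0; v 0 (inord 2)]).
  apply: max_poly_roots; rewrite ?enum_uniq ?frob_poly_eq0 //.
  by apply/allP=> x; rewrite mem_enum inE.
have S0 : 0 \in S by rewrite inE root_frob_poly0.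
have : (1 < #|S :\ 0%R|)%N by move: S2; rewrite (cardsD1 0) S0.
case/card_gt1P=> x [y []]; rewrite !in_setD1 => /andP[x0 Sx] /andP[y0 Sy] xy.
have Sxy : x + y \in S.
  move: Sx Sy; rewrite !inE !rootE => /eqP Sx /eqP Sy.
  by rewrite horner_frob_polyD // Sx Sy addr0.
apply/eqP; rewrite eqn_leq le4 /=.
have us : uniq [:: 0; x; y; x + y].
  have xyC : x + y != 0 by rewrite addr_eq0 (oppr_pchar2 ch2).
  rewrite /= !inE !negb_or eq_sym x0 eq_sym y0 eq_sym xyC xy /=.
  by rewrite -[X in X == x + y]addr0 (inj_eq (addrI x)) eq_sym y0
    -[X in X == x + y]add0r (inj_eq (addIr y)) eq_sym x0.
rewrite -[4]/(size [:: 0; x; y; x + y]) -(card_uniqP us).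
by apply/subset_leq_card/subsetP => z; rewrite !inE => /or4P[]/eqP->;
  move: S0 Sx Sy Sxy; rewrite !inE.
Qed.

Definition frob_col (K : fieldType) (x : K) : 'cV[K]_3 :=
  \col_i x ^+ nth 0 [:: 1; 2; 4] i.

Lemma mul_frob_col (K : fieldType) (v : 'rV[K]_3) (x : K) :
  v *m frob_col x = (frob_poly v).[x]%:M.
Proof.
apply/rowP=> i; rewrite (ord1 i) !mxE horner_frob_poly !big_ord_recl big_ord0.
rewrite !mxE /= addr0 addrA expr1 mulr1n; congr (_ + v 0 _ * _ + v 0 _ * _);
  by apply/val_inj; rewrite /= ?inordK.
Qed.

(** Taking the kernel of a linear form makes the dimension a matter of rank and nullity. *)
Definition frob_plane (K : fieldType) (x : K) : {vspace 'rV[K]_3} :=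
  lker (linfun (mulmxr (frob_col x) : 'rV[K]_3 -> 'rV[K]_1)).

Lemma mem_frob_plane (K : fieldType) (x : K) (v : 'rV[K]_3) :
  (v \in frob_plane x) = root (frob_poly v) x.
Proof.
rewrite memv_ker lfunE /= mul_frob_col rootE.
apply/eqP/eqP => [/rowP/(_ 0)|->]; last by rewrite raddf0.
by rewrite !mxE mulr1n.
Qed.

Lemma dim_frob_plane (K : fieldType) (x : K) : x != 0 -> \dim (frob_plane x) == 2.
Proof.
move=> x0; set f := linfun (mulmxr (frob_col x) : 'rV[K]_3 -> 'rV[K]_1).
have /esym := limg_ker_dim f fullv; rewrite capfv dimvf /= => d3.
suff l1 : \dim (limg f) = 1%N.
  by move: d3; rewrite l1 /dim /= /frob_plane -/f addn1 => -[<-].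
apply/eqP; rewrite eqn_leq; apply/andP; split.
  by apply: leq_trans (dimvS (subvf _)) _; rewrite dimvf.
rewrite lt0n dimv_eq0; apply/negP => /eqP f0.
(* The first basis vector is sent to [x], so the form is nonzero and its image is all of the
   one-dimensional target. *)
have : f (delta_mx 0 0) \in limg f by rewrite memv_img ?memvf.
rewrite f0 memv0 lfunE /= => /eqP/rowP/(_ 0).
by rewrite -rowE !mxE => /eqP; rewrite (negPf x0).
Qed.

Lemma frob_plane_inj (K : fieldType) (x y : K) :
  y != 0 -> frob_plane x = frob_plane y -> x = y.
Proof.
(* This [v] is chosen so that its polynomial is [X * (X - x)], whose only possible nonzero root is
   [x]. *)
move=> y0 exy; pose v : 'rV[K]_3 := \row_i [:: - x; 1; 0]`_i.
have hv z : (frob_poly v).[z] = z * (z - x).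
  by rewrite horner_frob_poly !mxE /= inordK //=; ring.
have : v \in frob_plane x by rewrite mem_frob_plane rootE hv subrr mulr0.
rewrite exy mem_frob_plane rootE hv mulf_eq0 (negPf y0) subr_eq0.
by move/eqP.
Qed.

Definition frob_line (K : fieldType) (x : {x : K | x != 0}) : proj_line K :=
  exist _ (frob_plane (val x)) (dim_frob_plane (valP x)).

Lemma frob_line_inj (K : fieldType) : injective (@frob_line K).
Proof.
by move=> x y /(congr1 val) exy; apply: val_inj; apply: frob_plane_inj (valP y) exy.
Qed.

Lemma lies_on_frob_line (K : fieldType) (p : proj_point K) (x : {x : K | x != 0}) :
  lies_on p (frob_line x) = root (frob_poly (vpick (val p))) (val x).
Proof.
rewrite -mem_frob_plane /lies_on /=; apply/idP/idP => [/subvP -> //|px].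
  exact: memv_pick.
(* A projective point is spanned by any of its nonzero vectors, so testing the picked one
   suffices. *)
have -> : val p = <[vpick (val p)]>%VS.
  apply/esym/eqP; rewrite eqEdim -memvE memv_pick (eqP (valP p)) dim_vline.
  by rewrite lt0b vpick0 -dimv_eq0 (eqP (valP p)).
by rewrite -memvE.
Qed.

Definition frob_arrangement (K : finFieldType) : line_arrangement K :=
  [fset frob_line x | x : {x : K | x != 0}]%fset.

Lemma card_frob_arrangement (K : finFieldType) :
  #|` frob_arrangement K|%fset = #|K|.-1.
Proof.
rewrite card_imfset /=; last exact: frob_line_inj.
by rewrite -cardE card_sig cardC1.
Qed.

(** The successor accounts for the root 0, which is always present but gives no line: its linear
    form vanishes. *)
Lemma card_lines_through_frob (K : finFieldType) (p : proj_point K) :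
  #|[set x : K | root (frob_poly (vpick (val p))) x]| =
  #|` lines_through (frob_arrangement K) p|%fset.+1.
Proof.
set S := [set x | _].
have -> : lines_through (frob_arrangement K) p =
    [fset frob_line x | x in [pred x | lies_on p (frob_line x)]]%fset.
  apply/fsetP=> l; rewrite !inE; apply/andP/imfsetP.
    by case=> /imfsetP[x _ ->] px; exists x.
  by case=> x px ->; split=> //; apply/imfsetP; exists x.
rewrite card_imfset /=; last exact: frob_line_inj.
have S0 : 0 \in S by rewrite inE root_frob_poly0.
rewrite (cardsD1 0) S0 add1n -cardE; congr _.+1.
rewrite -(card_imset _ val_inj); apply: eq_card => x; rewrite !inE.
apply/andP/imsetP => [[x0 Sx]|[y]].
  by exists (exist _ x x0); rewrite // -topredE /= lies_on_frob_line.
by rewrite -topredE /= lies_on_frob_line => Sy ->; split=> //; apply: (valP y).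
Qed.

Lemma frob_arrangement_triple (K : finFieldType) (p : proj_point K) :
  2 \in [pchar K] -> intersection_point (frob_arrangement K) p ->
  triple_point (frob_arrangement K) p.
Proof.
move=> ch2; rewrite /intersection_point /triple_point => ip.
have v0 : vpick (val p) != 0 by rewrite vpick0 -dimv_eq0 (eqP (valP p)).
(* At least two lines through [p] mean at least three roots, hence four, hence three lines. *)
have := card_roots_frob_poly ch2 v0; rewrite card_lines_through_frob ltnS.
by move=> /(_ ip) [->].
Qed.

Local Close Scope ring_scope.

Theorem theoremA (k : nat) (hk : 2 <= k) :
  exists (K : fieldType) (A : line_arrangement K),
    [/\ #|` A|%fset = \sum_(0 <= i < k.+1) 2 ^ i,
        \sum_(0 <= i < k.+1) 2 ^ i = 2 ^ k.+1 - 1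
      & forall p : proj_point K, intersection_point A p -> triple_point A p].
Proof.
have sumE : \sum_(0 <= i < k.+1) 2 ^ i = 2 ^ k.+1 - 1.
  by rewrite big_mkord subn1 predn_exp mul1n.
have [K ch2 cardK] := PrimePowerField (isT : prime 2) (ltn0Sn k).
exists K, (frob_arrangement K); split=> // [|p]; last exact: frob_arrangement_triple.
by rewrite card_frob_arrangement cardK sumE subn1.
Qed.
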